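(* Let $\mathcal{G}$ be a finite connected graph with a chosen spanning tree $T$ and chosen orientations $e_1,\dots,e_r$ of the $r$ edges not in $T$. For a based loop $l_\bullet$ set $$\check N_{i,j}(l_\bullet)=N_{e_i,e_j}(l_\bullet)+N_{-e_i,-e_j}(l_\bullet)-N_{e_i,-e_j}(l_\bullet)-N_{-e_i,e_j}(l_\bullet).$$ Let $[X_i,X_j]=X_iX_j-X_jX_i$ and $[\gamma_i,\gamma_j]=\gamma_i^{-1}\gamma_j^{-1}\gamma_i\gamma_j$. Let $l$ be a loop. Then: a) If $h_1(l)=0$ (i.e. if $d(l)\ge2$) and $l_\bullet$ is any based loop representing $l$, then for all $1\le i<j\le r$ the number $\check N_{i,j}(l_\bullet)-\check N_{j,i}(l_\bullet)$ is independent of the choice of the base point, and is therefore denoted $\check N_{i,j}(l)-\check N_{j,i}(l)$. These numbers vanish for all $1\le i<j\le r$ if and only if $d(l)>2$. b) If $d(l)=2$, then $P_l=\frac12\sum_{1\le i<j\le r}\bigl(\check N_{i,j}(l)-\check N_{j,i}(l)\bigr)[X_i,X_j]$. c) If $d(l)\ge2$, then $h_2(l)=\frac12\sum_{1\le i<j\le r}\bigl(\check N_{i,j}(l)-\check N_{j,i}(l)\bigr)\,h_2([\gamma_i,\gamma_j])$ in $H_2$.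
   Context: Graph: $\mathcal{G}$ is a finite connected non-oriented graph with vertex set $X$ and edge set $E$, with no loop edges and no multiple edges; $r=|E|-|X|+1$. The opposite of an oriented edge $e$ is denoted $-e$. A based loop is a path $(x_0,x_1,\dots,x_n,x_0)$ along edges; a loop is an equivalence class of based loops under cyclic shift. For a based loop $l_\bullet$ and oriented edges $e,f$, $N_{e,f}(l_\bullet)$ is the number of pairs of times $s<t$ such that $l_\bullet$ crosses $e$ at time $s$ and $f$ at time $t$. Fundamental group: with $T$ and $e_1,\dots,e_r$ fixed, the fundamental group of $\mathcal{G}$ (at any base point) is identified with the free group $\Gamma$ on generators $\gamma_1,\dots,\gamma_r$: a based loop that successively crosses the oriented non-tree edges $\varepsilon_1e_{i_1},\dots,\varepsilon_ke_{i_k}$ ($\varepsilon_a=\pm1$) has homotopy class $\gamma_{i_1}^{\varepsilon_1}\cdots\gamma_{i_k}^{\varepsilon_k}$. A loop $l$ therefore determines a conjugacy class of $\Gamma$. Lower central series: $\Gamma^{(1)}=\Gamma$, $\Gamma^{(n+1)}=[\Gamma^{(n)},\Gamma]$, $H_n=\Gamma^{(n)}/\Gamma^{(n+1)}$ (abelian, written additively; $H_2$ is a free abelian group), and $h_n:\Gamma^{(n)}\to H_n$ is the projection. The degree $d(l)$ is the largest $n$ such that the conjugacy class of $l$ is contained in $\Gamma^{(n)}$, with $d(l)=\infty$ if $l$ is homotopic to a point. If $d(l)\ge n$, $h_n(l)$ is the common value of $h_n$ on the conjugacy class of $l$. Signature: let $X_1,\dots,X_r$ be non-commuting symbols. For $g=\gamma_{j_1}^{n_1}\cdots\gamma_{j_m}^{n_m}\in\Gamma$,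 $S(g)=e^{n_1X_{j_1}}\cdots e^{n_mX_{j_m}}$ (a formal power series in the non-commuting $X_j$). $P_g$ is the sum of the terms of lowest degree of $S(g)-1$; it depends only on the conjugacy class of $g$, and $P_l$ denotes $P_g$ for any $g$ in the conjugacy class of $l$. *)

(* Defs.v *)
From HB Require Import structures.
From mathcomp Require Import all_boot all_order all_algebra.
From mathcomp Require Import boolp classical_sets constructive_ereal.

Set Implicit Arguments.
Unset Strict Implicit.
Unset Printing Implicit Defensive.

Import Order.TTheory GRing.Theory Num.Theory.

Local Open Scope classical_set_scope.
Local Open Scope quotient_scope.
Local Open Scope ring_scope.

Record cgraph := CGraph {
  vert :> finType;
  adj : rel vert;
  adj_sym : symmetric adj;
  adj_irr : irreflexive adj;
  vert_gt0 : (0 < #|vert|)%N;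
  adj_connected : forall x y, connect adj x y }.

Section Graph.
Variable G : cgraph.

Definition uedge (a : G * G) : {set G} := [set a.1; a.2]%SET.
Definition opp_edge (a : G * G) : G * G := (a.2, a.1).

Definition edges : {set {set G}} :=
  [set uedge a | a : G * G & adj a.1 a.2]%SET.

(* |E| - |X| + 1 ; the subtraction never truncates since G is connected *)
Definition betti : nat := (#|edges| + 1 - #|G|)%N.

Definition tree_adj (T : {set {set G}}) : rel G :=
  fun x y => uedge (x, y) \in T.

Definition spanning_tree (T : {set {set G}}) : Prop :=
  [/\ T \subset edges,
      forall x y, connect (tree_adj T) x y
    & forall c : seq G, (2 < size c)%N -> ~ ucycle (tree_adj T) c].

(* [e] lists the edges not in [T], each exactly once with one orientation *)
Definition cotree_orientation (T : {set {set G}}) (e : 'I_betti -> G * G) :=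
  injective (uedge \o e) /\ [set uedge (e i) | i : 'I_betti]%SET = edges :\: T.

(* The based loop (x_0, ..., x_n, x_0) is encoded by the sequence x_0, ..., x_n. *)
Definition bloop : Type := {c : seq G | (c != [::]) && cycle (@adj G) c}.
HB.instance Definition _ := Choice.on bloop.

Definition crossings (b : bloop) : seq (G * G) := zip (val b) (rot 1 (val b)).

Definition crosses (b : bloop) (a : G * G) (t : nat) : bool :=
  onth (crossings b) t == Some a.

Definition Ncross (a f : G * G) (b : bloop) : nat :=
  #|[set st : 'I_(size (val b)) * 'I_(size (val b)) |
      [&& (st.1 < st.2)%N, crosses b a st.1 & crosses b f st.2]]%SET|.

Definition cyclic_shift (b b' : bloop) : bool :=
  `[< exists k, val b' = rot k (val b) >].

Lemma cyclic_shift_refl : reflexive cyclic_shift.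
Proof. by move=> b; apply/asboolP; exists 0; rewrite rot0. Qed.

Lemma rot_rot_ex (A : Type) (s : seq A) m n :
  exists k, rot m (rot n s) = rot k s.
Proof.
case: (leqP n (size s)) => hn; last first.
  by exists m; rewrite (rot_oversize (ltnW hn)).
case: (leqP m (size s)) => hm; last first.
  by exists n; rewrite rot_oversize ?size_rot // ltnW.
by eexists; rewrite rot_add_mod.
Qed.

Lemma cyclic_shift_sym : symmetric cyclic_shift.
Proof.
suff H b b' : cyclic_shift b b' -> cyclic_shift b' b.
  by move=> b b'; apply/idP/idP; apply: H.
move=> /asboolP [k E]; apply/asboolP; rewrite E.
by exists (size (rot k (val b)) - k)%N; rewrite -/(rotr _ _) rotK.
Qed.

Lemma cyclic_shift_trans : transitive cyclic_shift.
Proof.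
move=> b2 b1 b3 /asboolP [k E] /asboolP [m E']; apply/asboolP.
by rewrite E' E; exact: rot_rot_ex.
Qed.

Canonical cyclic_shift_equiv := EquivRel cyclic_shift
  cyclic_shift_refl cyclic_shift_sym cyclic_shift_trans.

Definition loop : Type := {eq_quot cyclic_shift_equiv}.
HB.instance Definition _ := Choice.on loop.
HB.instance Definition _ := Quotient.on loop.

Definition represents (b : bloop) (l : loop) : Prop := \pi_loop b = l.

Lemma represents_shift (b b' : bloop) l :
  represents b l -> (represents b' l <-> exists k, val b' = rot k (val b)).
Proof.
rewrite /represents => <-; split=> [E|H].
  have /eqmodP/asboolP // : b = b' %[mod {eq_quot cyclic_shift_equiv}].
  by symmetry; exact: E.
suff : b' = b %[mod {eq_quot cyclic_shift_equiv}] by [].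
by symmetry; apply/eqmodP/asboolP.
Qed.

End Graph.

Arguments betti : clear implicits.

Section FreeGroup.
Variable r : nat.

(* (i, false) stands for gamma_i and (i, true) for its inverse *)
Definition letter : Type := ('I_r * bool)%type.
Definition linv (a : letter) : letter := (a.1, ~~ a.2).

Definition reduced (w : seq letter) : bool := sorted (fun a b => b != linv a) w.

Definition freeg : Type := {w : seq letter | reduced w}.
HB.instance Definition _ := Choice.on freeg.

Definition push (a : letter) (w : seq letter) : seq letter :=
  if w is b :: w' then if b == linv a then w' else a :: w else [:: a].

Definition wmul (u v : seq letter) : seq letter := foldr push v u.
Definition winv (u : seq letter) : seq letter := rev (map linv u).

Lemma linvK : involutive linv.
Proof. by case=> i b; rewrite /linv negbK. Qed.

Lemma push_reduced a w : reduced w -> reduced (push a w).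
Proof.
case: w => [|b w] //= hw; case: ifP => [_|E /=]; last by rewrite E.
exact: path_sorted hw.
Qed.

Lemma wmul_reduced u v : reduced v -> reduced (wmul u v).
Proof. by move=> hv; elim: u => //= a u; exact: push_reduced. Qed.

Lemma push_linvr a w : reduced w -> push a (push (linv a) w) = w.
Proof.
case: w => [|b w] /=; first by rewrite eqxx.
rewrite linvK; case: (eqVneq b a) => [->|ne] /=; last by rewrite eqxx.
by case: w => [|c w] //= /andP [/negbTE->].
Qed.

Lemma push_linv a w : reduced w -> push (linv a) (push a w) = w.
Proof. by move=> hw; rewrite -{2}(linvK a) push_linvr. Qed.

Lemma wmul_push a u w : reduced w -> wmul (push a u) w = push a (wmul u w).
Proof.
move=> hw; case: u => [|b u] //=; case: eqP => [->|] //=.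
by rewrite push_linvr // wmul_reduced.
Qed.

Lemma wmulA u v w : reduced w -> wmul u (wmul v w) = wmul (wmul u v) w.
Proof. by move=> hw; elim: u => //= a u ->; rewrite wmul_push. Qed.

Lemma wmul0 u : reduced u -> wmul u [::] = u.
Proof.
elim: u => //= a u IH; rewrite /reduced /= => hu.
rewrite (IH (path_sorted hu)).
by case: u hu {IH} => [|b u] //= /andP [/negbTE->].
Qed.

Lemma winv_reduced u : reduced u -> reduced (winv u).
Proof.
rewrite /reduced /winv rev_sorted sorted_map.
apply: sub_sorted => a b; apply: contra => /= /eqP E.
by rewrite -(linvK b) E linvK.
Qed.

Lemma winvK : involutive winv.
Proof. by move=> u; rewrite /winv map_rev revK mapK //; exact: linvK. Qed.

Lemma winv_mul u v : reduced v -> wmul (winv u) (wmul u v) = v.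
Proof.
rewrite /winv; elim: u v => [|a u IH] v hv //=.
rewrite rev_cons -cats1 /wmul foldr_cat /= push_linv //; last exact: wmul_reduced.
exact: IH.
Qed.

Definition fone : freeg := exist (fun w => reduced w) [::] isT.
Definition fmul (g h : freeg) : freeg :=
  exist (fun w => reduced w) _ (wmul_reduced (val g) (valP h)).
Definition finv (g : freeg) : freeg :=
  exist (fun w => reduced w) _ (winv_reduced (valP g)).

Lemma fmulA : associative fmul.
Proof. by move=> g h k; apply: val_inj; rewrite /= wmulA //; exact: (valP k). Qed.
Lemma fmul1g : left_id fone fmul.
Proof. by move=> g; exact: val_inj. Qed.
Lemma fmulg1 : right_id fone fmul.
Proof. by move=> g; apply: val_inj; rewrite /= wmul0 //; exact: (valP g). Qed.
Lemma fmulVg : left_inverse fone finv fmul.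
Proof.
move=> g; apply: val_inj => /=.
by rewrite -{2}(wmul0 (valP g)) winv_mul.
Qed.
Lemma fmulgV : right_inverse fone finv fmul.
Proof.
move=> g; apply: val_inj => /=.
have := @winv_mul (winv (val g)) [::] isT.
by rewrite winvK wmul0 //; exact: winv_reduced (valP g).
Qed.

HB.instance Definition _ :=
  isGroup.Build freeg fmulA fmul1g fmulg1 fmulVg fmulgV.

Definition gam (i : 'I_r) : freeg := exist (fun w => reduced w) [:: (i, false)] isT.

End FreeGroup.

Section LowerCentral.
Variable gT : groupType.
Implicit Types (x y z : gT) (n : nat).
Local Open Scope group_scope.

Definition subgroup (A : set gT) : Prop :=
  A 1 /\ forall x y, A x -> A y -> A (x * y^-1).

(* Gamma^(1) = Gamma ; the value at 0 is a convention *)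
Fixpoint lcs n : set gT :=
  match n with
  | 0 => setT
  | m.+1 => if m is 0 then setT
            else smallest subgroup
                   [set g | exists x y, lcs m x /\ g = [~ x, y]]
  end.

Arguments lcs n : simpl never.

Lemma lcsSS n : lcs n.+2 =
  smallest subgroup [set g | exists x y, lcs n.+1 x /\ g = [~ x, y]].
Proof. by []. Qed.

Lemma lcs_subgroup n : subgroup (lcs n).
Proof.
case: n => [|[|n]] //; rewrite lcsSS; split=> [A [[h _] _]|x y] //.
move=> hx hy A hA; have [[_ h] _] := hA.
by apply: h; [exact: hx|exact: hy].
Qed.

Lemma lcs1 n : lcs n 1.
Proof. by have [] := lcs_subgroup n. Qed.
Lemma lcsV n x : lcs n x -> lcs n x^-1.
Proof.
move=> hx; have [h1 h] := lcs_subgroup n.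
by rewrite -[x^-1]mul1g; exact: h.
Qed.
Lemma lcsM n x y : lcs n x -> lcs n y -> lcs n (x * y).
Proof.
move=> hx hy; have [h1 h] := lcs_subgroup n.
by rewrite -[y]invgK; apply: h => //; exact: lcsV.
Qed.

Lemma lcs_comm n x y : lcs n x -> lcs n.+1 [~ x, y].
Proof.
case: n => [|n] // hx; rewrite lcsSS => A [_]; apply.
by exists x, y.
Qed.

Lemma lcsJ n x z : lcs n x -> lcs n (x ^ z).
Proof.
elim: n x z => [|[|n] IH] x z //.
rewrite !lcsSS => hx A hA; have [[h1 hF] hg] := hA.
have := hx [set u | A (u ^ z)]; apply; split; first split.
- by rewrite /= conj1g.
- by move=> u v /= hu hv; rewrite conjMg conjVg; exact: hF.
- move=> _ [u [v [hu ->]]] /=; apply: hg; exists (u ^ z), (v ^ z).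
  by split; [exact: IH|rewrite conjRg].
Qed.

Definition lcs_sub n : Type := {g : gT | g \in lcs n}.
HB.instance Definition _ n := Choice.on (lcs_sub n).

Definition lcs_rel n (x y : lcs_sub n) : bool :=
  (val x)^-1 * val y \in lcs n.+1.

Lemma lcs_rel_refl n : reflexive (@lcs_rel n).
Proof. by move=> x; rewrite /lcs_rel mulVg inE; exact: lcs1. Qed.

Lemma lcs_rel_sym n : symmetric (@lcs_rel n).
Proof.
suff H (x y : lcs_sub n) : lcs_rel x y -> lcs_rel y x.
  by move=> x y; apply/idP/idP; apply: H.
by rewrite /lcs_rel !inE => /lcsV; rewrite invgM invgK.
Qed.

Lemma lcs_rel_trans n : transitive (@lcs_rel n).
Proof.
move=> y x z; rewrite /lcs_rel !inE => hxy hyz.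
by have := lcsM hxy hyz; rewrite mulgA mulgK.
Qed.

Canonical lcs_rel_equiv n := EquivRel (@lcs_rel n)
  (@lcs_rel_refl n) (@lcs_rel_sym n) (@lcs_rel_trans n).

(* H_n = Gamma^(n) / Gamma^(n+1), written additively *)
Definition lcs_quo n : Type := {eq_quot lcs_rel_equiv n}.
HB.instance Definition _ n := Choice.on (lcs_quo n).
HB.instance Definition _ n := Quotient.on (lcs_quo n).

Lemma lcs1_in n : 1 \in lcs n. Proof. by rewrite inE; exact: lcs1. Qed.
Lemma lcsM_in n (x y : lcs_sub n) : val x * val y \in lcs n.
Proof.
by rewrite inE; apply: lcsM; [have := valP x|have := valP y]; rewrite inE.
Qed.
Lemma lcsV_in n (x : lcs_sub n) : (val x)^-1 \in lcs n.
Proof. by rewrite inE; apply: lcsV; have := valP x; rewrite inE. Qed.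

Definition lcs_one n : lcs_sub n := exist (fun g => g \in lcs n) 1 (lcs1_in n).
Definition lcs_mul n (x y : lcs_sub n) : lcs_sub n := exist (fun g => g \in lcs n) _ (lcsM_in x y).
Definition lcs_inv n (x : lcs_sub n) : lcs_sub n := exist (fun g => g \in lcs n) _ (lcsV_in x).

Definition lcs_pi n (x : lcs_sub n) : lcs_quo n := \pi_(lcs_quo n) x.
Lemma lcs_piK n (a : lcs_quo n) : lcs_pi (repr a) = a.
Proof. exact: reprK. Qed.

Definition lcs_zero n : lcs_quo n := lcs_pi (lcs_one n).
Definition lcs_add n (a b : lcs_quo n) : lcs_quo n :=
  lcs_pi (lcs_mul (repr a) (repr b)).
Definition lcs_opp n (a : lcs_quo n) : lcs_quo n := lcs_pi (lcs_inv (repr a)).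

Lemma lcs_quoP n (x y : lcs_sub n) :
  lcs_pi x = lcs_pi y <-> lcs n.+1 ((val x)^-1 * val y).
Proof.
split=> [E|H].
  have /eqmodP : x = y %[mod {eq_quot lcs_rel_equiv n}] by exact: E.
  by rewrite /= /lcs_rel inE.
suff : x = y %[mod {eq_quot lcs_rel_equiv n}] by [].
by apply/eqmodP; rewrite /= /lcs_rel inE.
Qed.

Lemma lcs_addE n (x y : lcs_sub n) :
  lcs_add (lcs_pi x) (lcs_pi y) = lcs_pi (lcs_mul x y).
Proof.
rewrite /lcs_add; apply/lcs_quoP => /=.
set x' := repr _; set y' := repr _.
have hx : lcs n.+1 ((val x')^-1 * val x) by apply/lcs_quoP; rewrite lcs_piK.
have hy : lcs n.+1 ((val y')^-1 * val y) by apply/lcs_quoP; rewrite lcs_piK.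
have -> : (val x' * val y')^-1 * (val x * val y)
  = ((val x')^-1 * val x) ^ (val y') * ((val y')^-1 * val y).
  by rewrite conjgE invgM !mulgA mulgK.
by apply: lcsM => //; exact: lcsJ.
Qed.

Lemma lcs_oppE n (x : lcs_sub n) : lcs_opp (lcs_pi x) = lcs_pi (lcs_inv x).
Proof.
rewrite /lcs_opp; apply/lcs_quoP => /=; set x' := repr _.
have hx : lcs n.+1 ((val x')^-1 * val x) by apply/lcs_quoP; rewrite lcs_piK.
rewrite invgK; have /lcsV/lcsJ := hx => /(_ (val x')^-1).
by rewrite conjgE invgM !invgK !mulgA mulgK.
Qed.

Lemma lcs_addA n : associative (@lcs_add n).
Proof.
move=> a b c; rewrite -[a]lcs_piK -[b]lcs_piK -[c]lcs_piK !lcs_addE.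
by congr (lcs_pi _); apply: val_inj; rewrite /= mulgA.
Qed.
Lemma lcs_addC n : commutative (@lcs_add n).
Proof.
move=> a b; rewrite -[a]lcs_piK -[b]lcs_piK !lcs_addE; apply/lcs_quoP => /=.
have -> : (val (repr a) * val (repr b))^-1 * (val (repr b) * val (repr a))
  = [~ val (repr b), val (repr a)].
  by rewrite commgEl conjgE invgM !mulgA.
by apply: lcs_comm; have := valP (repr b); rewrite inE.
Qed.
Lemma lcs_add0 n : left_id (lcs_zero n) (@lcs_add n).
Proof.
move=> a; rewrite -[a]lcs_piK lcs_addE.
by congr (lcs_pi _); apply: val_inj; rewrite /= mul1g.
Qed.
Lemma lcs_addN n : left_inverse (lcs_zero n) (@lcs_opp n) (@lcs_add n).
Proof.
move=> a; rewrite -[a]lcs_piK lcs_oppE lcs_addE.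
by congr (lcs_pi _); apply: val_inj; rewrite /= mulVg.
Qed.

HB.instance Definition _ n := GRing.isZmodule.Build (lcs_quo n)
  (@lcs_addA n) (@lcs_addC n) (@lcs_add0 n) (@lcs_addN n).

(* The projection h_n : Gamma^(n) -> H_n, extended by 0 outside Gamma^(n). *)
Definition lcs_proj n (g : gT) : lcs_quo n := lcs_pi (insubd (lcs_one n) g).

Lemma lcs_projM n x y : lcs n x -> lcs n y ->
  lcs_proj n (x * y) = (lcs_proj n x + lcs_proj n y)%R.
Proof.
move=> hx hy; rewrite /lcs_proj [RHS]lcs_addE; congr (lcs_pi _).
by apply: val_inj; rewrite /= !insubdK // inE //; exact: lcsM.
Qed.

Lemma lcs_proj_eq n x y : lcs n x -> lcs n y ->
  lcs_proj n x = lcs_proj n y <-> lcs n.+1 (x^-1 * y).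
Proof.
move=> hx hy; rewrite /lcs_proj.
by split=> [/lcs_quoP|h]; [|apply/lcs_quoP]; rewrite !insubdK ?inE.
Qed.

Lemma lcs_projJ n x z : lcs n x -> lcs_proj n (x ^ z) = lcs_proj n x.
Proof.
move=> hx; symmetry; apply/lcs_proj_eq => //; first exact: lcsJ.
exact: lcs_comm.
Qed.

End LowerCentral.

Arguments lcs : clear implicits, simpl never.

Section Series.
Variable r : nat.

(* [F w] is the coefficient of the monomial X_{w_0} X_{w_1} ... *)
Definition ncps : Type := seq 'I_r -> rat.
HB.instance Definition _ := gen_eqMixin ncps.
HB.instance Definition _ := gen_choiceMixin ncps.
Implicit Types (F K L : ncps).

Definition ps_zero : ncps := fun=> 0.
Definition ps_add F K : ncps := fun w => F w + K w.
Definition ps_opp F : ncps := fun w => - F w.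
Definition ps_one : ncps := fun w => (w == [::])%:R.
Definition ps_mul F K : ncps :=
  fun w => \sum_(k < (size w).+1) F (take k w) * K (drop k w).
Definition ps_scale (a : rat) F : ncps := fun w => a * F w.

Lemma ps_addA : associative ps_add.
Proof. by move=> F K L; apply/funext => w; rewrite /ps_add addrA. Qed.
Lemma ps_addC : commutative ps_add.
Proof. by move=> F K; apply/funext => w; rewrite /ps_add addrC. Qed.
Lemma ps_add0 : left_id ps_zero ps_add.
Proof. by move=> F; apply/funext => w; rewrite /ps_add add0r. Qed.
Lemma ps_addN : left_inverse ps_zero ps_opp ps_add.
Proof. by move=> F; apply/funext => w; rewrite /ps_add addNr. Qed.

HB.instance Definition _ :=
  GRing.isZmodule.Build ncps ps_addA ps_addC ps_add0 ps_addN.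

Lemma ps_mul_nil F K : ps_mul F K [::] = F [::] * K [::].
Proof. by rewrite /ps_mul big_ord1. Qed.

Lemma ps_mul_cons F K x w : ps_mul F K (x :: w) =
  F [::] * K (x :: w) + ps_mul (fun v => F (x :: v)) K w.
Proof. by rewrite /ps_mul big_ord_recl. Qed.

Lemma ps_mulDl : left_distributive ps_mul ps_add.
Proof.
move=> F K L; apply/funext => w; rewrite /ps_mul /ps_add -big_split /=.
by apply: eq_bigr => k _; rewrite mulrDl.
Qed.
Lemma ps_mulDr : right_distributive ps_mul ps_add.
Proof.
move=> F K L; apply/funext => w; rewrite /ps_mul /ps_add -big_split /=.
by apply: eq_bigr => k _; rewrite mulrDr.
Qed.
Lemma ps_mulZl a F K : ps_mul (ps_scale a F) K = ps_scale a (ps_mul F K).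
Proof.
apply/funext => w; rewrite /ps_mul /ps_scale big_distrr /=.
by apply: eq_bigr => k _; rewrite mulrA.
Qed.
Lemma ps_mul_cons_fun F K x : (fun v => ps_mul F K (x :: v)) =
  ps_add (ps_scale (F [::]) (fun v => K (x :: v)))
         (ps_mul (fun v => F (x :: v)) K).
Proof. by apply/funext => w; rewrite ps_mul_cons. Qed.

Lemma ps_mulA : associative ps_mul.
Proof.
move=> F K L; apply/funext => w; elim: w F => [|x w IH] F.
  by rewrite !ps_mul_nil mulrA.
rewrite !ps_mul_cons ps_mul_cons_fun ps_mulDl ps_mulZl IH !ps_mul_nil.
by rewrite /ps_add /ps_scale mulrDr mulrA addrA.
Qed.
Lemma ps_mul0w K w : ps_mul (fun=> 0) K w = 0.
Proof. by rewrite /ps_mul big1 // => k _; rewrite mul0r. Qed.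
Lemma ps_mul1 : left_id ps_one ps_mul.
Proof.
move=> F; apply/funext => -[|x w]; first by rewrite ps_mul_nil mul1r.
by rewrite ps_mul_cons mul1r [X in _ + X]ps_mul0w addr0.
Qed.
Lemma ps_mulr1 : right_id ps_one ps_mul.
Proof.
move=> F; apply/funext => w; elim: w F => [|x w IH] F.
  by rewrite ps_mul_nil mulr1.
by rewrite ps_mul_cons mulr0 add0r IH.
Qed.
Lemma ps_1neq0 : ps_one != 0.
Proof. by apply/eqP => /(congr1 (@^~ [::])) /eqP; rewrite oner_eq0. Qed.

HB.instance Definition _ := GRing.Zmodule_isNzRing.Build ncps
  ps_mulA ps_mul1 ps_mulr1 ps_mulDl ps_mulDr ps_1neq0.

Lemma ps_scaleA a b F : ps_scale a (ps_scale b F) = ps_scale (a * b) F.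
Proof. by apply/funext => w; rewrite /ps_scale mulrA. Qed.
Lemma ps_scale1 : left_id 1 ps_scale.
Proof. by move=> F; apply/funext => w; rewrite /ps_scale mul1r. Qed.
Lemma ps_scaleDr : right_distributive ps_scale +%R.
Proof. by move=> a F K; apply/funext => w; rewrite /ps_scale mulrDr. Qed.
Lemma ps_scaleDl F : {morph ps_scale^~ F : a b / a + b}.
Proof. by move=> a b; apply/funext => w; rewrite /ps_scale mulrDl. Qed.

HB.instance Definition _ := GRing.Zmodule_isLmodule.Build rat ncps
  ps_scaleA ps_scale1 ps_scaleDr ps_scaleDl.

Definition varX (i : 'I_r) : ncps := fun w => (w == [:: i])%:R.

(* e^{a X_i} = sum_k a^k X_i^k / k! *)
Definition expX (a : rat) (i : 'I_r) : ncps :=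
  fun w => if all (pred1 i) w then a ^+ size w / (size w)`!%:R else 0.

(* The signature, computed letter by letter on the reduced word; see [sigM] and
   [sig_gam] below for its value on arbitrary products of powers of generators. *)
Definition sig (g : freeg r) : ncps :=
  \prod_(a <- val g) expX ((-1) ^+ a.2) a.1.

(* Sum of the terms of lowest degree (0 for the zero series): the coefficient
   of w is kept iff all coefficients of strictly smaller degree vanish. *)
Definition lowest_part F : ncps :=
  fun w => if [forall k : 'I_(size w), forall v : k.-tuple 'I_r, F v == 0]
           then F w else 0.

Definition Plow (g : freeg r) : ncps := lowest_part (sig g - 1).

Lemma expXD a b i : expX a i * expX b i = expX (a + b) i.
Proof.
apply/funext => w; rewrite [LHS]/(ps_mul _ _ _) /ps_mul /expX.
have [hw|/negbTE hw] := boolP (all (pred1 i) w); last first.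
  apply: big1 => k _; move: hw; rewrite -{1}(cat_take_drop k w) all_cat.
  by case: (all _ (take _ _)) => /= [->|_]; rewrite ?mulr0 ?mul0r.
rewrite addrC exprDn big_distrl /=; apply: eq_bigr => k _.
have hk : (k <= size w)%N by rewrite -ltnS.
move: (hw); rewrite -{1}(cat_take_drop k w) all_cat => /andP [-> ->].
rewrite size_takel // size_drop -(bin_fact hk) !natrM -(mulr_natr (_ * _)).
set n := size w.
have f0 m : m`!%:R != 0 :> rat by rewrite pnatr_eq0 -lt0n fact_gt0.
have c0 : 'C(n, k)%:R != 0 :> rat by rewrite pnatr_eq0 -lt0n bin_gt0.
rewrite !invfM [LHS]mulrACA [b ^+ _ * _]mulrC -[RHS]mulrA; congr (_ * _).
by rewrite mulVKf.
Qed.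

Lemma expX0 i : expX 0 i = 1.
Proof.
apply/funext => -[|x w] /=; first by rewrite /expX /= expr0 fact0 divr1.
by rewrite /expX /= expr0n /= mul0r if_same.
Qed.

Lemma sig1 : sig 1%g = 1.
Proof. exact: big_nil. Qed.

Lemma sigM g h : sig (g * h)%g = sig g * sig h.
Proof.
rewrite /sig; change (val (g * h)%g) with (wmul (val g) (val h)).
elim: (val g) => [|a u IH]; first by rewrite big_nil mul1r.
rewrite big_cons -mulrA -IH /=; case: (wmul u (val h)) => [|b w] /=.
  by rewrite big_cons.
case: eqP => [->|_]; rewrite !big_cons // mulrA expXD.
by case: a => i [] /=; rewrite ?expr1 ?expr0 ?addrN ?addNr expX0 mul1r.
Qed.

Lemma sig_gam i n : sig (gam i ^+ n)%g = expX n%:R i.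
Proof.
elim: n => [|n IH]; first by rewrite sig1 expX0.
by rewrite expgS sigM IH /sig big_seq1 /= expr0 expXD -natr1 addrC.
Qed.

Lemma sig_gamV i n : sig (gam i ^- n)%g = expX (- n%:R) i.
Proof.
rewrite -[LHS]mulr1 -(expX0 i) -(addrN n%:R) -expXD mulrA -sig_gam -sigM.
by rewrite mulVg sig1 mul1r.
Qed.

Lemma sig_nil g : sig g [::] = 1.
Proof.
rewrite /sig; elim: (val g) => [|a u IH]; first by rewrite big_nil.
rewrite big_cons [LHS]ps_mul_nil IH mulr1.
by rewrite /expX /= expr0 fact0 divr1.
Qed.

Definition vanish F n := forall w, (size w < n)%N -> F w = 0.

Lemma lowest_partE F w :
  lowest_part F w = if `[< vanish F (size w) >] then F w else 0.
Proof.
rewrite /lowest_part; congr (if _ then _ else _).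
apply/forallP/asboolP => [H v hv|H k].
  by have /forallP/(_ (in_tuple v))/eqP := H (Ordinal hv).
by apply/forallP => v; apply/eqP/H; rewrite size_tuple.
Qed.

Lemma lowest_part_eq F K :
  (forall w, vanish F (size w) -> K w = F w) -> lowest_part K = lowest_part F.
Proof.
move=> H.
have V n : vanish F n <-> vanish K n.
  split=> [hF w hw|].
    by rewrite H ?hF // => v hv; apply: hF; exact: ltn_trans hw.
  elim: n => [|n IH] // hK w.
  have hF : vanish F n by apply: IH => v hv; apply: hK; rewrite ltnS ltnW.
  rewrite ltnS leq_eqVlt => /orP [/eqP E|]; last exact: hF.
  by rewrite -H ?E // hK // E.
apply/funext => w; rewrite !lowest_partE.
have -> : `[< vanish K (size w) >] = `[< vanish F (size w) >].
  by apply/asboolP/asboolP => /V.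
by case: asboolP => // /H.
Qed.

Lemma lowest_part_mull (U F : ncps) : U [::] = 1 -> lowest_part (U * F) = lowest_part F.
Proof.
move=> hU; apply: lowest_part_eq => w hF.
rewrite [LHS]/(ps_mul _ _ _) /ps_mul big_ord_recl /= take0 drop0 hU mul1r.
rewrite big1 ?addr0 // => k _; rewrite hF ?mulr0 // size_drop /= /bump /= add1n.
by case: (size w) k => [[]|n k] //; rewrite subSS ltnS leq_subr.
Qed.

Lemma lowest_part_mulr (U F : ncps) : U [::] = 1 -> lowest_part (F * U) = lowest_part F.
Proof.
move=> hU; apply: lowest_part_eq => w hF.
rewrite [LHS]/(ps_mul _ _ _) /ps_mul big_ord_recr /= take_size drop_size hU mulr1.
rewrite big1 ?add0r // => k _; rewrite hF ?mul0r // size_takel //.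
exact: ltnW.
Qed.

Lemma PlowJ g h : Plow (g ^ h)%g = Plow g.
Proof.
have E : sig (g ^ h)%g - 1 = sig h^-1%g * ((sig g - 1) * sig h).
  rewrite mulrBl mul1r mulrBr -!sigM -conjgE; congr (_ - _).
  by rewrite mulVg sig1.
by rewrite /Plow E lowest_part_mull ?lowest_part_mulr ?sig_nil.
Qed.

End Series.

Section LoopInvariants.
Variables (G : cgraph) (e : 'I_(betti G) -> G * G).
Local Notation Gam := (freeg (betti G)).

(* the contribution of one crossed edge: tree edges contribute 1 *)
Definition step (a : G * G) : Gam :=
  if [pick i | e i == a] is Some i then gam i
  else if [pick i | opp_edge (e i) == a] is Some i then (gam i)^-1%g
  else 1%g.

Definition hclass (b : bloop G) : Gam :=
  \big[ *%g/1%g]_(a <- crossings b) step a.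

Lemma crossings_rot (b b' : bloop G) k :
  val b' = rot k (val b) -> crossings b' = rot k (crossings b).
Proof.
move=> E; rewrite /crossings E rot_rot.
set s := val b; set t := rot 1 s; have : size s = size t by rewrite size_rot.
move: s t => s t hs.
have [hk|hk] := leqP (size s) k.
  by rewrite !rot_oversize // -?hs // size_zip -hs minnn.
rewrite -{2}(cat_take_drop k s) -{2}(cat_take_drop k t).
have hk1 : size (take k s) = k by rewrite size_takel // ltnW.
have hk2 : size (take k t) = k by rewrite size_takel // -hs ltnW.
rewrite [in RHS]zip_cat ?hk1 ?hk2 //.
rewrite -{3}(_ : size (zip (take k s) (take k t)) = k).
  by rewrite rot_size_cat -zip_cat // !size_drop hs.
by rewrite size_zip hk1 hk2 minnn.
Qed.

Lemma hclass_shift (b b' : bloop G) k :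
  val b' = rot k (val b) -> exists h, hclass b' = (hclass b ^ h)%g.
Proof.
move=> /crossings_rot E.
exists (\big[ *%g/1%g]_(a <- take k (crossings b)) step a).
rewrite /hclass E /rot -{3}(cat_take_drop k (crossings b)) !big_cat /=.
by rewrite conjgE !mulgA mulVg mul1g.
Qed.

Definition cclass (l : loop G) : set Gam :=
  [set g | exists b h, represents b l /\ g = (hclass b ^ h)%g].

Lemma cclassE (b : bloop G) l g :
  represents b l -> cclass l g <-> exists h, g = (hclass b ^ h)%g.
Proof.
move=> hb; split=> [[b' [h [hb' ->]]]|[h ->]]; last by exists b, h.
have [k /hclass_shift [h' ->]] := (represents_shift b' hb).1 hb'.
by exists (h' * h)%g; rewrite conjgM.
Qed.

(* [+oo] when l is homotopic to a point, i.e. when its class is that of 1.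
   Otherwise the largest n exists because free groups are residually nilpotent,
   and the default value of [xget] is not used. *)
Definition degree (l : loop G) : \bar int :=
  if `[< cclass l 1%g >] then +oo%E
  else (Posz (xget 0%N [set n | cclass l `<=` lcs Gam n /\
                  forall m, cclass l `<=` lcs Gam m -> (m <= n)%N]))%:E.

(* h_n(l) and P_l do not depend on the element of the conjugacy class of l:
   see [h_loopE] and [P_loopE]. *)
Definition h_loop (n : nat) (l : loop G) : lcs_quo Gam n :=
  lcs_proj n (hclass (repr l)).

Definition P_loop (l : loop G) : ncps (betti G) := Plow (hclass (repr l)).

Lemma represents_repr (l : loop G) : represents (repr l) l.
Proof. exact: reprK. Qed.

Lemma h_loopE n l g : cclass l `<=` lcs Gam n -> cclass l g ->
  lcs_proj n g = h_loop n l.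
Proof.
move=> hl /(cclassE _ (represents_repr l)) [h ->]; apply: lcs_projJ.
apply: hl; apply/(cclassE _ (represents_repr l)).
by exists 1%g; rewrite conjg1.
Qed.

Lemma P_loopE l g : cclass l g -> Plow g = P_loop l.
Proof. by move=> /(cclassE _ (represents_repr l)) [h ->]; exact: PlowJ. Qed.

Definition Ncheck (i j : 'I_(betti G)) (b : bloop G) : int :=
  (Ncross (e i) (e j) b)%:Z + (Ncross (opp_edge (e i)) (opp_edge (e j)) b)%:Z
  - (Ncross (e i) (opp_edge (e j)) b)%:Z - (Ncross (opp_edge (e i)) (e j) b)%:Z.

End LoopInvariants.

(* Main.v *)
(** Let [g] be the class of a based loop in the free group. The lower central
    series is detected by the signature: [S(x) - 1] starts in degree at least [n]
    for [x] in [Gamma^(n)], and [S] is faithful, so the degree of a loop is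
    attained. For [i != j] the coefficient of [X_i X_j] in [S(g)] is the number
    [N_ij], and the shuffle relation [N_ij + N_ji = c_i c_j], with [c_i] the
    coefficient of [X_i], gives [N_ij - N_ji = 2 N_ij] as soon as [h_1] vanishes.
    On [Gamma^(2)] both [h_2] and [N_ij] are homomorphisms; on a commutator
    [[x, y]] they are bilinear in the abelianisations of [x] and [y], which
    yields [h_2(g) = sum_(i < j) N_ij h_2([gamma_i, gamma_j])]. *)

Require Import Defs.
From HB Require Import structures.
From mathcomp Require Import all_boot all_order all_algebra.
From mathcomp Require Import boolp classical_sets constructive_ereal ring.

Set Implicit Arguments.
Unset Strict Implicit.
Unset Printing Implicit Defensive.

Import Order.TTheory GRing.Theory Num.Theory.
Local Open Scope ring_scope.

(** * The lower central series *)

Section LowerCentralSeries.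
Variable gT : groupType.
Implicit Types (x y z : gT) (n : nat).
Local Open Scope group_scope.

(** Minimality of the generated subgroup, applied to the set of elements satisfying [P], becomes an
    induction principle. *)
Lemma lcsSS_ind n (P : gT -> Prop) : P 1 ->
  (forall x y, P x -> P y -> P (x * y^-1)) ->
  (forall x y, lcs gT n.+1 x -> P [~ x, y]) ->
  forall x, lcs gT n.+2 x -> P x.
Proof.
move=> P1 PM PR x; rewrite lcsSS => /(_ [set y | P y]%classic); apply.
by split=> [|_ [y [z [hy ->]]]]; [split | exact: PR].
Qed.

Lemma lcsW n x : lcs gT n.+1 x -> lcs gT n x.
Proof.
elim: n x => [|[|n] IH] x //; apply: lcsSS_ind => [|y z hy hz|y z hy].
- exact: lcs1.
- by apply: lcsM => //; exact: lcsV.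
- by apply: lcs_comm; exact: IH.
Qed.

Lemma lcs_leq m n x : (m <= n)%N -> lcs gT n x -> lcs gT m x.
Proof.
move=> /subnK <-; elim: (n - m)%N => [|k IH] //.
by rewrite addSn => /lcsW.
Qed.

Lemma lcs_proj1 n : lcs_proj n (1 : gT) = 0%R.
Proof.
by apply: (addrI (lcs_proj n 1)); rewrite -lcs_projM ?mulg1 ?addr0 //; exact: lcs1.
Qed.

Lemma lcs_projV n x : lcs gT n x -> lcs_proj n x^-1 = (- lcs_proj n x)%R.
Proof.
move=> hx; apply: (addrI (lcs_proj n x)).
by rewrite -lcs_projM ?mulgV ?subrr ?lcs_proj1 //; exact: lcsV.
Qed.

Lemma lcs_proj_eq0 n x : lcs gT n x -> lcs_proj n x = 0%R <-> lcs gT n.+1 x.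
Proof.
move=> hx; rewrite -lcs_proj1 lcs_proj_eq //; last exact: lcs1.
by rewrite mulg1; split=> /lcsV; rewrite ?invgK.
Qed.

Local Notation h2 := (lcs_proj 2).

Lemma lcs2R x y : lcs gT 2 [~ x, y].
Proof. exact: lcs_comm. Qed.

(** In [xy, z] = [x, z]^y [y, z] the conjugation by [y] is invisible to [h2]. *)
Lemma lcs_proj2Ml x y z : h2 [~ x * y, z] = (h2 [~ x, z] + h2 [~ y, z])%R.
Proof.
have -> : [~ x * y, z] = [~ x, z] ^ y * [~ y, z].
  by rewrite !commgEl !conjgE !invgM !mulgA !mulgK.
by rewrite lcs_projM ?lcs_projJ //; try apply: lcsJ; exact: lcs2R.
Qed.

Lemma lcs_proj2C x y : h2 [~ x, y] = (- h2 [~ y, x])%R.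
Proof. by rewrite -lcs_projV ?invgR //; exact: lcs2R. Qed.

Lemma lcs_proj2Vl x z : h2 [~ x^-1, z] = (- h2 [~ x, z])%R.
Proof.
apply: (addrI (h2 [~ x, z])).
by rewrite -lcs_proj2Ml mulgV comm1g lcs_proj1 subrr.
Qed.

End LowerCentralSeries.

(** * Coefficients of the signature *)

Section Signature.
Variable r : nat.
Implicit Types (g h x y : freeg r) (i j : 'I_r).

(** Induction on the length of the reduced word, splitting off its first letter. *)
Lemma freeg_ind (P : freeg r -> Prop) : P 1%g -> (forall i, P (gam i)) ->
  (forall x y, P x -> P y -> P (x * y)%g) -> (forall x, P x -> P x^-1%g) ->
  forall x, P x.
Proof.
move=> P1 Pg PM PV x; have [u] := ubnP (size (val x)).
elim: u x => // n IH x; case E : (val x) => [|a u] /=.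
  by move=> _; rewrite (_ : x = 1%g) //; exact: val_inj.
rewrite ltnS => hn; have hx : reduced (a :: u) by rewrite -E; exact: (valP x).
have hu : reduced u by exact: path_sorted hx.
pose la : freeg r := if a.2 then (gam a.1)^-1%g else gam a.1.
pose y : freeg r := exist (fun w => reduced w) u hu.
have -> : x = (la * y)%g.
  apply: val_inj; rewrite E; have -> : val (la * y)%g = push a u.
    by rewrite /la; case: a {la E hx} => i [].
  (* No cancellation occurs in [push a u], because [a :: u] is reduced. *)
  by case: u hx {E hn y hu} => [|b u] //= /andP [/negbTE->].
by apply: PM (IH y hn); rewrite /la; case: a.2; [apply: PV|]; exact: Pg.
Qed.

Lemma ncps_mulE (F K : ncps r) w :
  (F * K) w = \sum_(k < (size w).+1) F (take k w) * K (drop k w).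
Proof. by []. Qed.

Lemma ncps_addE (F K : ncps r) w : (F + K) w = F w + K w.
Proof. by []. Qed.

Lemma ncps_oppE (F : ncps r) w : (- F) w = - F w.
Proof. by []. Qed.

Lemma ncps_scaleE a (F : ncps r) w : (a *: F) w = a * F w.
Proof. by []. Qed.

Lemma ncps_sumE (I : Type) (s : seq I) (P : pred I) (F : I -> ncps r) w :
  (\sum_(i <- s | P i) F i) w = \sum_(i <- s | P i) F i w.
Proof. exact: (big_morph (fun F : ncps r => F w)). Qed.

Lemma sig_sub1E g w : (sig g - 1) w = sig g w - (w == [::])%:R.
Proof. by []. Qed.

Lemma sigM1 g h i : sig (g * h)%g [:: i] = sig g [:: i] + sig h [:: i].
Proof. by rewrite sigM ncps_mulE !big_ord_recl big_ord0 /= !sig_nil; ring. Qed.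

Lemma sigM2 g h i j : sig (g * h)%g [:: i; j] =
  sig g [:: i; j] + sig g [:: i] * sig h [:: j] + sig h [:: i; j].
Proof. by rewrite sigM ncps_mulE !big_ord_recl big_ord0 /= !sig_nil; ring. Qed.

Lemma sig1E w : sig (1%g : freeg r) w = (w == [::])%:R.
Proof. by rewrite sig1. Qed.

Lemma sigV1 g i : sig g^-1%g [:: i] = - sig g [:: i].
Proof.
by apply: (addrI (sig g [:: i])); rewrite -sigM1 mulgV sig1E subrr.
Qed.

Lemma sigV2 g i j :
  sig g^-1%g [:: i; j] = sig g [:: i] * sig g [:: j] - sig g [:: i; j].
Proof.
have := sigM2 g (g^-1)%g i j; rewrite mulgV sig1E sigV1 /= => E.
by apply: (addrI (sig g [:: i; j] - sig g [:: i] * sig g [:: j])); rewrite -mulrN -E; ring.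
Qed.

Lemma sig_gamE k (w : seq 'I_r) : sig (gam k) w = if all (pred1 k) w then ((size w)`!)%:R^-1 else 0.
Proof. by rewrite -[gam k]expg1 sig_gam /expX expr1n mul1r. Qed.

(** This is the coefficient of X_i X_j in the Lie bracket of the linear parts of S(x) and S(y). *)
Lemma sigR2 x y i j : sig [~ x, y]%g [:: i; j] =
  sig x [:: i] * sig y [:: j] - sig x [:: j] * sig y [:: i].
Proof. by rewrite commgEl conjgE !(sigM2, sigM1, sigV1, sigV2); ring. Qed.

(** The relation is stable under products and inverses. On a generator its only nonzero case is 1/2
    + 1/2 = 1, where 1/2 comes from the exponential series. *)
Lemma sig_shuffle g i j :
  sig g [:: i; j] + sig g [:: j; i] = sig g [:: i] * sig g [:: j].
Proof.
elim/freeg_ind: g => [|k|x y Hx Hy|x Hx].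
- by rewrite !sig1E mulr0 addr0.
- by rewrite !sig_gamE /= !factS fact0 !muln1; case: (i == k); case: (j == k) => /=; field.
- rewrite !sigM2 !sigM1 mulrDl !mulrDr -Hx -Hy; ring.
- by rewrite !sigV2 !sigV1 mulrNN (mulrC (sig x [:: j])) -Hx; ring.
Qed.

(** However a word shorter than [m + n] is split, its prefix is shorter than [m] or its suffix is
    shorter than [n]. *)
Lemma vanish_mul (F K : ncps r) m n : vanish F m -> vanish K n -> vanish (F * K) (m + n).
Proof.
move=> hF hK w hw; rewrite ncps_mulE big1 // => k _.
have [km|mk] := ltnP k m; first by rewrite hF ?mul0r // size_take_min gtn_min km.
rewrite hK ?mulr0 // size_drop; have := ltn_ord k; rewrite ltnS => kw.
by rewrite -(ltn_add2l k) subnKC // (leq_trans hw) // leq_add2r.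
Qed.

(** With A = S(x) - 1 and B = S(y) - 1, one has S([x, y]) - 1 = S(x^-1 y^-1) (A B - B A). Since B
    has no constant term, a commutator gains one degree over A. *)
Lemma lcs_vanish n g : lcs (freeg r) n g -> vanish (sig g - 1) n.
Proof.
have V1 h : vanish (sig h - 1) 1.
  by move=> [|//] _; rewrite sig_sub1E sig_nil.
have VB (F K : ncps r) m : vanish F m -> vanish K m -> vanish (F - K) m.
  by move=> hF hK w hw; rewrite ncps_addE ncps_oppE hF ?hK ?subr0.
elim: n g => [|[|n] IH] g; [by [] | by move=> _; exact: V1 | ].
move: g; apply: lcsSS_ind => [|x y hx hy|x y /IH hx].
- by move=> w _; rewrite sig1 subrr.
- have -> : sig (x * y^-1)%g - 1 = ((sig x - 1) - (sig y - 1)) * sig y^-1%g.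
    rewrite opprB addrA subrK mulrBl -!sigM mulgV sig1 //.
  by rewrite -[n.+2]addn0; apply: vanish_mul => //; exact: VB.
- have -> : sig [~ x, y]%g - 1 = sig (x^-1 * y^-1)%g *
      ((sig x - 1) * (sig y - 1) - (sig y - 1) * (sig x - 1)).
    have -> : (sig x - 1) * (sig y - 1) - (sig y - 1) * (sig x - 1) = sig (x * y)%g - sig (y * x)%g.
      rewrite !sigM !mulrBr !mulrBl !mul1r !mulr1.
      (* After expansion the identity is linear in four series; it is checked on coefficients,
         because [ring] needs a commutative ring. *)
      move: (sig x) (sig y) (sig x * _) (sig y * _) => X Y A B; apply/funext => w.
      change (A w - Y w - (X w - ps_one w) - (B w - X w - (Y w - ps_one w)) = A w - B w).
      by ring.
    by rewrite mulrBr -!sigM commgEl conjgE !mulgA -[(_ * y * x)%g]mulgA -invgM mulVg sig1.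
  rewrite -[n.+2]add0n; apply: vanish_mul => //; apply: VB.
  + by rewrite -addn1; apply: vanish_mul.
  + by rewrite -add1n; apply: vanish_mul.
Qed.

End Signature.

(** * Residual nilpotence *)

Section Residual.
Variable r : nat.
Implicit Types (g : freeg r) (s : seq ('I_r * rat)).

(* A word without equal neighbours takes at most one letter from each factor,
   so as long as the product it must take exactly one letter from each. *)
Lemma syllables_coef s w : sorted (fun i j => i != j) w -> (size s <= size w)%N ->
  (\prod_(p <- s) expX p.2 p.1 : ncps r) w =
    if w == map fst s then \prod_(p <- s) p.2 else 0.
Proof.
elim: s w => [|[i n] s IH] w hw hs; first by rewrite !big_nil; case: w hw hs.
case: w hw hs => [|x w] //= hw; rewrite ltnS => hs; rewrite !big_cons /=.
rewrite ncps_mulE /= !big_ord_recl /= take0 drop0 IH; last exact: leqW; last by [].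
have /negbTE -> : x :: w != map fst s.
  by apply: contraTneq hs => /(congr1 size); rewrite size_map /= => <-; rewrite ltnn.
rewrite mulr0 add0r IH //; last exact: path_sorted hw.
rewrite [X in _ + X]big1 ?addr0 => [|k _]; last first.
  case: w hw {hs} k => [|y w] /= hw k; first by case: k.
  rewrite [expX _ _ _]/expX /= ifF ?mul0r //; apply: contraTF hw.
  by move=> /and3P [/eqP -> /eqP -> _]; rewrite eqxx.
rewrite /expX /= andbT eqseq_cons.
by case: eqP => _ /=; rewrite ?mul0r // expr1 divr1; case: eqP; rewrite ?mulr0.
Qed.

(** In a reduced word, adjacent letters with the same index have the same sign, so exponents within
    a syllable never cancel. The sign condition on [n] carries this through the induction. *)
Lemma reduced_syllables a u : reduced (a :: u) -> exists s n,
  [/\ 0 < (-1) ^+ a.2 * n, all (fun p => p.2 != 0) s,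
      sorted (fun i j => i != j) (map fst ((a.1, n) :: s))
    & \prod_(b <- a :: u) expX ((-1) ^+ b.2) b.1 =
      \prod_(p <- (a.1, n) :: s) expX p.2 p.1 :> ncps r].
Proof.
elim: u a => [|b u IH] a /= hu.
  exists [::], ((-1) ^+ a.2); rewrite !big_seq1; split=> //.
  by rewrite -expr2 sqrr_sign.
have /andP [hab /IH [s [n [hn hs ss E]]]] := hu.
have [Eab|nab] := eqVneq a.1 b.1.
  have Es : a.2 = b.2.
    move: hab; rewrite /linv; case: a b Eab {hu IH hn E ss} => [i [] [j []]] //= ->;
    by rewrite eqxx.
  exists s, ((-1) ^+ a.2 + n); split=> //.
  - by rewrite mulrDr -expr2 sqrr_sign Es addr_gt0.
  - by rewrite Eab.
  - by rewrite big_cons E !big_cons /= mulrA Eab expXD.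
exists ((b.1, n) :: s), ((-1) ^+ a.2); split=> //.
- by rewrite -expr2 sqrr_sign.
- rewrite /= hs andbT; apply: contraTneq hn => ->; by rewrite mulr0 ltxx.
- by move: ss; rewrite /= nab.
- by rewrite big_cons E !big_cons.
Qed.

Lemma sig_faithful g : g != 1%g -> exists2 w, w != [::] & sig g w != 0.
Proof.
case: g => [[|a u]] hu.
  by move=> /eqP []; exact: val_inj.
move=> _; have [s [n [hn hs ss E]]] := reduced_syllables hu.
(* At the word of syllable indices the coefficient is the product of the exponents, all nonzero. *)
exists (map fst ((a.1, n) :: s)) => //.
rewrite /sig [val _]/= E syllables_coef ?size_map // eqxx.
rewrite big_cons /= mulf_neq0 //; first by apply: contraTneq hn => ->; rewrite mulr0 ltxx.
by rewrite prodf_seq_neq0; apply: sub_all hs => p ->.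
Qed.

Lemma lcs_residual g : g != 1%g -> exists n, ~ lcs (freeg r) n g.
Proof.
move=> /sig_faithful [w w0 hw]; exists (size w).+1 => /lcs_vanish /(_ w (ltnSn _)).
rewrite sig_sub1E (negbTE w0) mulr0n subr0; exact/eqP.
Qed.

End Residual.

(** * The quotient H_2 *)

Section SecondQuotient.
Variable r : nat.
Implicit Types (g x y : freeg r) (i j : 'I_r).
Local Notation h2 := (lcs_proj 2).

Lemma lcs2_sig1 g i : lcs (freeg r) 2 g -> sig g [:: i] = 0.
Proof.
by move=> /lcs_vanish /(_ [:: i] isT); rewrite sig_sub1E subr0.
Qed.

Lemma lcs2_sigC g i j : lcs (freeg r) 2 g -> sig g [:: j; i] = - sig g [:: i; j].
Proof.
move=> hg; apply: (addrI (sig g [:: i; j])).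
by rewrite sig_shuffle subrr lcs2_sig1 ?mul0r.
Qed.

Lemma lcs2_sigii g i : lcs (freeg r) 2 g -> sig g [:: i; i] = 0.
Proof. by move=> hg; have /eqP := lcs2_sigC i i hg; rewrite -addr_eq0 -mulr2n mulrn_eq0 => /eqP. Qed.

(** The integers [c i] are the exponent sums of [x]; they are chosen before [y], so one family
    serves every [y]. *)
Lemma lcs_proj2_gaml x : exists2 c : 'I_r -> int,
  forall i, sig x [:: i] = (c i)%:~R &
  forall y, h2 [~ x, y]%g = \sum_i h2 [~ gam i, y]%g *~ c i.
Proof.
elim/freeg_ind: x => [|k|x y [c hc Hc] [d hd Hd]|x [c hc Hc]].
- exists (fun=> 0) => [i|y]; first by rewrite sig1E.
  by rewrite comm1g lcs_proj1 big1.
- exists (fun i => (i == k)%:R) => [i|y].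
    by rewrite sig_gamE /= andbT; case: eqP.
  rewrite (bigD1 k) //= eqxx mulr1z big1 ?addr0 // => i /negbTE ->.
  by rewrite mulr0z.
- exists (fun i => c i + d i) => [i|z]; first by rewrite sigM1 hc hd rmorphD.
  by rewrite lcs_proj2Ml Hc Hd -big_split; apply: eq_bigr => i _; rewrite mulrzDr.
- exists (fun i => - c i) => [i|z]; first by rewrite sigV1 hc rmorphN.
  by rewrite lcs_proj2Vl Hc -sumrN; apply: eq_bigr => i _; rewrite mulrNz.
Qed.

Lemma sum_pairs_lt (V : zmodType) (F : 'I_r -> 'I_r -> V) :
  (forall i, F i i = 0) ->
  \sum_i \sum_j F i j = \sum_(i < r) \sum_(j < r | (i < j)%N) (F i j + F j i).
Proof.
move=> F0; under [RHS]eq_bigr do rewrite big_split /=.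
rewrite big_split /= [X in _ = _ + X](exchange_big_dep xpredT) //= -big_split /=.
apply: eq_bigr => i _; rewrite (bigID (fun j : 'I_r => (i < j)%N)) /=; congr (_ + _).
rewrite (bigID (fun j : 'I_r => (j < i)%N)) /= [X in _ + X]big1 ?addr0.
  by apply: eq_bigl => j; case: ltngtP.
by move=> j; rewrite -!leqNgt -eqn_leq => /eqP/val_inj ->.
Qed.

Lemma lcs_proj2_gam x y (c d : 'I_r -> int) :
  (forall i, sig x [:: i] = (c i)%:~R) -> (forall i, sig y [:: i] = (d i)%:~R) ->
  h2 [~ x, y]%g = \sum_(i < r) \sum_(j < r | (i < j)%N)
    h2 [~ gam i, gam j]%g *~ (c i * d j - c j * d i).
Proof.
move=> hc hd.
have [c' hc' ->] := lcs_proj2_gaml x; have [d' hd' Hd] := lcs_proj2_gaml y.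
have Ec : c' = c by apply/funext => i; apply: (@intr_inj rat); rewrite -hc -hc'.
have Ed : d' = d by apply/funext => i; apply: (@intr_inj rat); rewrite -hd -hd'.
rewrite {}Ec {}Ed in Hd *.
transitivity (\sum_i \sum_j h2 [~ gam i, gam j]%g *~ (c i * d j)).
  (* Skew-symmetry transfers the expansion to the second argument. *)
  apply: eq_bigr => i _; rewrite lcs_proj2C Hd -sumrN mulrz_suml.
  by apply: eq_bigr => j _; rewrite -mulNrz -lcs_proj2C -mulrzA mulrC.
rewrite sum_pairs_lt => [|i]; last by rewrite commgg lcs_proj1 mul0rz.
apply: eq_bigr => i _; apply: eq_bigr => j _.
by rewrite [h2 [~ gam j, _]%g]lcs_proj2C mulNrz -mulrNz -mulrzDr.
Qed.

(** On the second term of the series [h2] and the degree two coefficients are additive, so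
    commutators decide. *)
Lemma lcs_proj2E g : lcs (freeg r) 2 g -> exists2 n : 'I_r -> 'I_r -> int,
  forall i j, sig g [:: i; j] = (n i j)%:~R &
  h2 g = \sum_(i < r) \sum_(j < r | (i < j)%N) h2 [~ gam i, gam j]%g *~ n i j.
Proof.
(* Membership is carried along, since additivity on products relies on it. *)
move=> hg; suff [] : lcs (freeg r) 2 g /\ (exists2 n : 'I_r -> 'I_r -> int,
  forall i j, sig g [:: i; j] = (n i j)%:~R &
  h2 g = \sum_(i < r) \sum_(j < r | (i < j)%N) h2 [~ gam i, gam j]%g *~ n i j) by [].
move: g hg; apply: lcsSS_ind.
- split; first exact: lcs1.
  exists (fun _ _ => 0) => [i j|]; first by rewrite sig1E.
  by rewrite lcs_proj1 big1 // => i _; rewrite big1.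
- move=> x y [hx [m Hm Em]] [hy [n Hn En]].
  have hV := lcsV hy; split; first exact: lcsM.
  exists (fun i j => m i j - n i j) => [i j|].
    by rewrite sigM2 sigV2 !lcs2_sig1 // Hm Hn rmorphB /= !mul0r addr0 add0r.
  rewrite lcs_projM // lcs_projV // Em En -sumrB; apply: eq_bigr => i _.
  by rewrite -sumrB; apply: eq_bigr => j _; rewrite mulrzBr.
- move=> x y _; split; first exact: lcs2R.
  have [c hc _] := lcs_proj2_gaml x; have [d hd _] := lcs_proj2_gaml y.
  exists (fun i j => c i * d j - c j * d i); last exact: lcs_proj2_gam.
  by move=> i j; rewrite sigR2 !hc !hd rmorphB !rmorphM.
Qed.

(** Vanishing coefficients make [h2 g] zero by [lcs_proj2E]; the converse is [lcs_vanish] in degree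
    two. *)
Lemma lcs3_sig2 g : lcs (freeg r) 2 g ->
  (forall i j, (i < j)%N -> sig g [:: i; j] = 0) <-> lcs (freeg r) 3 g.
Proof.
move=> hg; split=> [H|/lcs_vanish H i j _]; last first.
  by have := H [:: i; j] isT; rewrite sig_sub1E subr0.
have [n Hn En] := lcs_proj2E hg; apply/(lcs_proj_eq0 hg).
rewrite En big1 // => i _; rewrite big1 // => j /H.
by rewrite Hn => /eqP; rewrite intr_eq0 => /eqP ->.
Qed.

End SecondQuotient.

(** * Crossing numbers *)

Section PairCount.
Variable A : eqType.
Implicit Types (a f c : A) (s : seq A).

(** A recursive form of [Ncross], suited to induction on the list of crossings. *)
Fixpoint pair_count a f s : nat :=
  if s is c :: s' then ((c == a) * count_mem f s' + pair_count a f s')%N else 0%N.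

Lemma sum_onth f s : (\sum_(t < size s) (onth s t == Some f) = count_mem f s)%N.
Proof.
elim: s => [|c s IH] /=; first by rewrite big_ord0.
by rewrite big_ord_recl /= IH (inj_eq Some_inj).
Qed.

Lemma sum_onth_pairs a f s :
  (\sum_(u < size s) \sum_(t < size s)
    [&& u < t, onth s u == Some a & onth s t == Some f] = pair_count a f s)%N.
Proof.
elim: s => [|c s IH] /=; first by rewrite big_ord0.
rewrite big_ord_recl; congr (_ + _)%N.
  rewrite big_ord_recl /= add0n (inj_eq Some_inj) -sum_onth big_distrr /=.
  by apply: eq_bigr => t _; rewrite mulnb.
rewrite -IH; apply: eq_bigr => u _; rewrite big_ord_recl /= add0n.
by apply: eq_bigr => t _; rewrite /bump /= !add1n ltnS.
Qed.

End PairCount.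

Section Loops.
Variables (G : cgraph) (T : {set {set G}}) (e : 'I_(betti G) -> G * G).
Hypothesis he : cotree_orientation T e.
Local Notation r := (betti G).
Implicit Types (b : bloop G) (a c f : G * G) (i j k : 'I_r).

Lemma NcrossE a f b : Ncross a f b = pair_count a f (crossings b).
Proof.
have E : size (crossings b) = size (val b) by rewrite size_zip size_rot minnn.
rewrite -sum_onth_pairs E /Ncross -sum1dep_card.
rewrite pair_bigA big_mkcond /=.
by apply: eq_bigr => -[s t] _ /=; rewrite /crosses; case: ifP.
Qed.

Lemma cotree_inj : injective e.
Proof. by move=> i j E; apply: he.1; rewrite /= E. Qed.

(** Cardinality suffices: an edge of [G] has two elements because [adj] is irreflexive. *)
Lemma cotree_neq i : (e i).1 != (e i).2.
Proof.
have : uedge (e i) \in edges G :\: T by rewrite -he.2; apply/imsetP; exists i.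
rewrite inE => /andP [_ /imsetP [a]]; rewrite inE => ha /(congr1 (fun A : {set G} => #|A|)).
rewrite !cards2; case: eqVneq => // _.
by case: (eqVneq a.1 a.2) => // E; move: ha; rewrite E adj_irr.
Qed.

(** Opposite orientations share their underlying edge, so equality would force [i = j] and make
    [e i] a loop edge. *)
Lemma cotree_opp i j : e i != opp_edge (e j).
Proof.
apply/eqP => E; have ij : i = j.
  by apply: he.1; rewrite /= E /uedge /= finset.setUC.
have := cotree_neq i; move: E; rewrite -ij; case: (e i) => x y [<- _].
by rewrite eqxx.
Qed.

Lemma opp_edgeK : involutive (@opp_edge G).
Proof. by case. Qed.

Definition edge_sign i a : int := (a == e i)%:R - (a == opp_edge (e i))%:R.

Lemma sig_step1 a i : sig (step e a) [:: i] = (edge_sign i a)%:~R.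
Proof.
rewrite /step /edge_sign; case: pickP => [k /eqP <-|h1].
  rewrite sig_gamE /= andbT (inj_eq cotree_inj) (negbTE (cotree_opp _ _)) subr0 eq_sym.
  by case: eqP.
rewrite [a == _]eq_sym h1 sub0r; case: pickP => [k /eqP <-|h2].
  rewrite sigV1 sig_gamE /= andbT (can_eq opp_edgeK) (inj_eq cotree_inj) eq_sym.
  by case: eqP.
by rewrite [a == _]eq_sym h2 sig1E.
Qed.

(** A single crossing involves at most one generator, hence no mixed monomial. The case [i = j] is
    excluded because X_i^2 can have coefficient 1/2. *)
Lemma sig_step2 a i j : i != j -> sig (step e a) [:: i; j] = 0.
Proof.
move=> ij; have G0 k : sig (gam k) [:: i; j] = 0 /\ sig (gam k)^-1%g [:: i; j] = 0.
  rewrite sigV2 !sig_gamE /= !andbT; case: (eqVneq i k) => [<-|_] /=.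
    by rewrite [j == i]eq_sym (negbTE ij) mulr0 subr0.
  by rewrite mul0r subr0.
rewrite /step; case: pickP => [k _|_]; first exact: (G0 k).1.
by case: pickP => [k _|_]; [exact: (G0 k).2 | rewrite sig1E].
Qed.

Local Notation word s := (\big[ *%g/1%g]_(a <- s) step e a).

Lemma sig_word1 s i : sig (word s) [:: i] =
  ((count_mem (e i) s)%:Z - (count_mem (opp_edge (e i)) s)%:Z)%:~R.
Proof.
elim: s => [|c s IH]; first by rewrite big_nil sig1E.
rewrite big_cons sigM1 IH sig_step1 -rmorphD /= /edge_sign !PoszD -!natz.
by congr (_ %:~R); ring.
Qed.

(** Prepending a crossing [c] adds its sign for [i] times the signed count for [j] of the later
    crossings: this is the cross term of [sigM2]. *)
Lemma sig_word2 s i j : i != j -> sig (word s) [:: i; j] =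
  ((pair_count (e i) (e j) s)%:Z
   + (pair_count (opp_edge (e i)) (opp_edge (e j)) s)%:Z
   - (pair_count (e i) (opp_edge (e j)) s)%:Z
   - (pair_count (opp_edge (e i)) (e j) s)%:Z)%:~R.
Proof.
move=> ij; elim: s => [|c s IH]; first by rewrite big_nil sig1E.
rewrite big_cons sigM2 IH sig_step1 sig_step2 // sig_word1 add0r -rmorphM -rmorphD /=.
by rewrite /edge_sign !PoszD !PoszM -!natz; congr (_ %:~R); ring.
Qed.

Lemma sig_hclass2 b i j : i != j -> sig (hclass e b) [:: i; j] = (Ncheck e i j b)%:~R.
Proof. by move=> ij; rewrite sig_word2 // /Ncheck !NcrossE. Qed.

(** * Degree of a loop and depth of its class *)

Lemma cclass_lcs b (l : loop G) n : represents b l ->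
  (cclass e l `<=` lcs (freeg r) n)%classic <-> lcs (freeg r) n (hclass e b).
Proof.
move=> hb; split=> [H|H g /(cclassE _ _ hb) [h ->]]; last exact: lcsJ.
by apply/H/(cclassE _ _ hb); exists 1%g; rewrite conjg1.
Qed.

Lemma degree_geP b (l : loop G) n : represents b l ->
  ((n%:Z)%:E <= degree e l)%E <-> lcs (freeg r) n (hclass e b).
Proof.
move=> hb; rewrite /degree; case: asboolP => [/(cclassE _ _ hb) [h E]|H].
  rewrite leey; split=> // _; have -> : hclass e b = 1%g; last exact: lcs1.
  by apply: (can_inj (conjgK h)); rewrite -E conj1g.
set D := mkset _.
have g1 : hclass e b != 1%g.
  apply/eqP => E; apply: H; apply/(cclassE _ _ hb); exists 1%g.
  by rewrite conjg1 E.
have [N hN] := lcs_residual g1.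
(* The levels containing the class include 0 and are bounded by [N], so a largest one exists and
   [xget] does not return its default. *)
have exD : exists m, D m.
  pose P m := `[< lcs (freeg r) m (hclass e b) >].
  have P0 : exists m, P m by exists 0%N; apply/asboolP.
  have PN m : P m -> (m <= N)%N.
    move=> /asboolP hm; rewrite leqNgt; apply/negP => /ltnW Nm.
    by apply: hN; exact: lcs_leq Nm hm.
  case: (ex_maxnP P0 PN) => m /asboolP hm hmax; exists m; split.
    exact/(cclass_lcs _ hb).
  by move=> k /(cclass_lcs _ hb) hk; apply/hmax/asboolP.
have [/(cclass_lcs _ hb) h1 h2] := xgetPex 0%N exD.
rewrite lee_fin lez_nat; split=> [h|/(cclass_lcs _ hb)]; last exact: h2.
exact: lcs_leq h h1.
Qed.

Lemma degree_gt2 l : (2%:E < degree e l)%E = (3%:E <= degree e l)%E.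
Proof. by case: (degree e l) => [d| |] //; rewrite lte_fin lee_fin. Qed.

End Loops.

(** * The degree two part *)

Section QuadraticPart.
Variable r : nat.
Implicit Types (g : freeg r) (i j : 'I_r).

Lemma varXM i j w : (varX i * varX j) w = (w == [:: i; j])%:R.
Proof.
case: w => [|x [|y w]].
- by rewrite ncps_mulE big_ord1 mul0r.
- by rewrite ncps_mulE !big_ord_recl big_ord0 /= /varX /= mul0r mulr0 !addr0 eqseq_cons andbF.
rewrite ncps_mulE !big_ord_recl /= /varX /= mul0r add0r big1 => [|k _]; last first.
  by rewrite eqseq_cons andbF mul0r.
by rewrite !eqseq_cons andbT andbF mul0r !addr0 -natrM mulnb.
Qed.

Lemma quadratic_sumE (F : 'I_r -> 'I_r -> rat) w :
  \sum_(i < r) \sum_(j < r) F i j * (w == [:: i; j])%:R =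
    if w is [:: i; j] then F i j else 0.
Proof.
case: w => [|x [|y [|z w]]].
- by rewrite big1 // => i _; rewrite big1 // => j _; rewrite mulr0.
- by rewrite big1 // => i _; rewrite big1 // => j _; rewrite eqseq_cons andbF mulr0.
- rewrite (bigD1 x) //= (bigD1 y) //= eqxx mulr1 !big1 ?addr0 //.
    by move=> i ix; rewrite big1 // => j _; rewrite eqseq_cons eq_sym (negbTE ix) mulr0.
  by move=> j jy; rewrite !eqseq_cons [y == _]eq_sym (negbTE jy) andbF mulr0.
- by rewrite big1 // => i _; rewrite big1 // => j _; rewrite !eqseq_cons !andbF mulr0.
Qed.

(** Degrees below two vanish by [lcs_vanish], and some degree two coefficient survives by
    [lcs3_sig2]. *)
Lemma Plow_lcs2 g : lcs (freeg r) 2 g -> ~ lcs (freeg r) 3 g ->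
  Plow g = \sum_(i < r) \sum_(j < r | (i < j)%N)
    sig g [:: i; j] *: (varX i * varX j - varX j * varX i).
Proof.
move=> h2 h3; apply/funext => w; transitivity
  (\sum_(i < r) \sum_(j < r) sig g [:: i; j] * (w == [:: i; j])%:R).
  rewrite (quadratic_sumE (fun i j => sig g [:: i; j])) /Plow lowest_partE.
  have V2 := lcs_vanish h2; case: w => [|x [|y [|z w]]].
  - by rewrite V2 ?if_same.
  - by rewrite V2 ?if_same.
  - by rewrite asboolT // sig_sub1E subr0.
  - rewrite asboolF // => V; apply/h3/(lcs3_sig2 h2) => i j _.
    by have := V [:: i; j] isT; rewrite sig_sub1E subr0.
(* The diagonal is zero and the coefficients are antisymmetric, so transposed terms combine into
   brackets. *)
rewrite sum_pairs_lt => [|i]; last by rewrite lcs2_sigii // mul0r.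
rewrite ncps_sumE; apply: eq_bigr => i _; rewrite ncps_sumE; apply: eq_bigr => j _.
by rewrite ncps_scaleE ncps_addE ncps_oppE !varXM (lcs2_sigC i j h2); ring.
Qed.

End QuadraticPart.

Theorem proposition2 (G : cgraph) (T : {set {set G}}) (hT : spanning_tree T)
    (e : 'I_(betti G) -> G * G) (he : cotree_orientation T e) (l : loop G) :
  [/\
   (* a *)
   (h_loop e 1 l = 0 <-> (2%:E <= degree e l)%E) /\
   (h_loop e 1 l = 0 ->
     (forall b b' : bloop G, represents b l -> represents b' l ->
        forall i j : 'I_(betti G), (i < j)%N ->
          Ncheck e i j b - Ncheck e j i b = Ncheck e i j b' - Ncheck e j i b') /\
     (forall b : bloop G, represents b l ->
        ((forall i j : 'I_(betti G), (i < j)%N ->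
            Ncheck e i j b - Ncheck e j i b = 0)
         <-> (2%:E < degree e l)%E))),
   (* b *)
   degree e l = 2%:E ->
     forall b : bloop G, represents b l ->
       P_loop e l = 2^-1 *:
         \sum_(i < betti G) \sum_(j < betti G | (i < j)%N)
           (Ncheck e i j b - Ncheck e j i b)%:~R *:
             (varX i * varX j - varX j * varX i)
 & (* c *)
   (2%:E <= degree e l)%E ->
     forall b : bloop G, represents b l ->
       (forall i j : 'I_(betti G), (i < j)%N ->
          (2 %| Ncheck e i j b - Ncheck e j i b)%Z) /\
       h_loop e 2 l =
         \sum_(i < betti G) \sum_(j < betti G | (i < j)%N)
           lcs_proj 2 [~ gam i, gam j]%g
             *~ ((Ncheck e i j b - Ncheck e j i b) %/ 2)%Z].
Proof.
pose g b := hclass e b; pose F := freeg (betti G).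
have cl b : represents b l -> cclass e l (g b).
  by move=> hb; apply/(cclassE _ _ hb); exists 1%g; rewrite conjg1.
have deg2 b : represents b l -> (2%:E <= degree e l)%E <-> lcs F 2 (g b).
  by move=> hb; exact: (degree_geP e 2 hb).
have deg3 b : represents b l -> (2%:E < degree e l)%E <-> lcs F 3 (g b).
  by move=> hb; rewrite degree_gt2; exact: (degree_geP e 3 hb).
(* Antisymmetry of the degree two coefficients is the source of the factor 1/2 in the formulas. *)
have N2 b (i j : 'I_(betti G)) : lcs F 2 (g b) -> (i < j)%N ->
    Ncheck e i j b - Ncheck e j i b = 2 * Ncheck e i j b.
  move=> hg ij; have ne : i != j by rewrite neq_ltn ij.
  apply: (@intr_inj rat); rewrite rmorphB rmorphM /= -!(sig_hclass2 he) //; last by rewrite eq_sym.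
  by rewrite (lcs2_sigC i j hg); ring.
have sigN b (i j : 'I_(betti G)) : (i < j)%N -> sig (g b) [:: i; j] = (Ncheck e i j b)%:~R.
  by move=> ij; rewrite (sig_hclass2 he) // neq_ltn ij.
have h1P : h_loop e 1 l = 0 <-> (2%:E <= degree e l)%E.
  by rewrite (deg2 _ (represents_repr l)); exact: lcs_proj_eq0.
split; [split=> // h1; split | |].
- move=> b b' hb hb' i j ij; have hg := (deg2 _ hb).1 (h1P.1 h1).
  have hg' := (deg2 _ hb').1 (h1P.1 h1).
  rewrite !N2 //; congr (_ * _); apply: (@intr_inj rat); rewrite -!sigN //.
  (* Base point independence comes from that of [Plow]: as lower degrees vanish, its coefficient at
     [[:: i; j]] is that of the signature, even when zero. *)
  have := P_loopE (cl _ hb); rewrite -(P_loopE (cl _ hb')).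
  move=> /(congr1 (fun P : ncps _ => P [:: i; j])).
  by rewrite /Plow !lowest_partE !asboolT ?sig_sub1E ?subr0 //; exact: lcs_vanish.
- move=> b hb; have hg := (deg2 _ hb).1 (h1P.1 h1).
  rewrite (deg3 _ hb) -lcs3_sig2 //; split=> H i j ij.
    rewrite sigN //; apply/eqP; rewrite intr_eq0; move/eqP: (H i j ij).
    by rewrite N2 // mulf_eq0.
  by move: (H i j ij); rewrite N2 // sigN // => /eqP; rewrite intr_eq0 => /eqP ->.
- move=> d2 b hb.
  have hg : lcs F 2 (g b) by apply/(deg2 _ hb); rewrite d2.
  have hg3 : ~ lcs F 3 (g b) by move/(deg3 _ hb); rewrite d2 ltxx.
  rewrite -(P_loopE (cl _ hb)) Plow_lcs2 // scaler_sumr; apply: eq_bigr => i _.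
  rewrite scaler_sumr; apply: eq_bigr => j ij.
  by rewrite N2 // sigN // scalerA rmorphM /= mulrA mulVf // mul1r.
- move=> d2 b hb; have hg := (deg2 _ hb).1 d2.
  (* By [N2] the difference is even, so the integer division by 2 is exact. *)
  split=> [i j ij|]; first by rewrite N2 // dvdz_mulr.
  rewrite -(@h_loopE _ e 2 l (g b)) //; [|exact/(cclass_lcs _ _ hb)|exact: cl].
  have [n hn ->] := lcs_proj2E hg; apply: eq_bigr => i _; apply: eq_bigr => j ij.
  by rewrite N2 // mulKz //; congr (_ *~ _); apply: (@intr_inj rat); rewrite -hn sigN.
Qed.
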